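(* Let $G=\{\mathbf u\in\mathbb R^N:\ g_i(\mathbf u)\succ 0,\ 1\le i\le I\}$ be convex with $\mathrm{int}(G)\neq\emptyset$, suppose that the boundary of $G$ is piecewise $C^1$ (in the sense specified in the context, with $C^1$ pieces $\mathcal S_i$), and that, when $\mathbb I\neq\emptyset$, $$G\cap\Big(\bigcup_{\mathbf u_*\in\mathcal S_i}\{\mathbf u\in\mathbb R^N:\ (\mathbf u-\mathbf u_* )\cdot\mathbf n_{i*}=0\}\Big)=\emptyset\qquad\forall\, i\in\mathbb I ,$$ where $\mathbf n_{i*}$ is an inward-pointing normal vector of $\mathcal S_i$ at $\mathbf u_*$. Assume that each $\mathcal S_i$ has a parametric expression $$\mathcal S_i=\{\mathbf u_*=\mathbf U_i(\boldsymbol\theta_{i*}):\ \boldsymbol\theta_{i*}\in\Theta_i\subseteq\mathbb R^{N-1}\},$$ where $\mathbf U_i$ is a $C^1$ vector function on $\Theta_i$, and let $\boldsymbol\tau_{i,k}(\boldsymbol\theta_{i*}):=\partial\mathbf U_i/\partial\theta_{i*}^{(k)}$, $1\le k\le N-1$, where $\theta_{i*}^{(k)}$ is the $k$th component of $\boldsymbol\theta_{i*}$. If $$\bigwedge_{k=1}^{N-1}\boldsymbol\tau_{i,k}(\boldsymbol\theta_{i*})\neq\mathbf 0\qquad\forall\,\boldsymbol\theta_{i*}\in\Theta_i,\ 1\le i\le I,$$ then $G=G_*$, where $$G_*=\Big\{\mathbf u\in\mathbb R^N:\ \varphi_i(\mathbf u;\boldsymbol\theta_{i*})\succ 0\quad\forall\,\boldsymbol\theta_{i*}\in\Theta_i,\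 1\le i\le I\Big\},$$ $$\varphi_i(\mathbf u;\boldsymbol\theta_{i*}):=\big(\mathbf u-\mathbf U_i(\boldsymbol\theta_{i*})\big)\cdot\Big(\delta_{i*}\bigwedge_{k=1}^{N-1}\boldsymbol\tau_{i,k}(\boldsymbol\theta_{i*})\Big),$$ and each $\varphi_i$ is linear (affine) with respect to $\mathbf u$.
   Context: The index set $\{1,\dots,I\}$ is the disjoint union of $\mathbb I$ and $\widehat{\mathbb I}$; in the $i$-th constraint (of $G$ and of $G_*$) ''$\succ$'' means ''$>$'' if $i\in\mathbb I$ and ''$\ge$'' if $i\in\widehat{\mathbb I}$. The functions $g_i$ are not assumed concave, and $G$ need be neither open nor closed. Let $G_i:=\{\mathbf u\in\mathbb R^N:\ g_i(\mathbf u)\succ 0\}$ and $\mathcal S_i:=\partial G\cap\partial G_i$. ''The boundary of $G$ is piecewise $C^1$'' means: $\partial G=\bigcup_{1\le i\le I}\mathcal S_i$, each $\mathcal S_i$ is a $C^1$ hypersurface in $\mathbb R^N$, and for each $i$ the function $g_i$ is $C^1$ at all points of $\mathcal S_i$. It is the paper's standing setting that the sets $G_i=\{g_i>0\}$ are open for $i\in\mathbb I$ and $G_i=\{g_i\ge 0\}$ are closed for $i\in\widehat{\mathbb I}$. $\bigwedge_{k=1}^{N-1}\boldsymbol\tau_{i,k}=\boldsymbol\tau_{i,1}\times\cdots\times\boldsymbol\tau_{i,N-1}$ denotes the $(N-1)$-ary generalized cross product in $\mathbb R^N$: the unique vector $\mathbf w$ with $\mathbf w\cdot\mathbf x=\det(\boldsymbol\tau_{i,1},\dots,\boldsymbol\tau_{i,N-1},\mathbf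 x)$ for all $\mathbf x\in\mathbb R^N$. The factor $\delta_{i*}$ is a nonzero real number (it may depend on $\boldsymbol\theta_{i*}$), chosen such that the normal vector $\mathbf n_{i*}=\delta_{i*}\bigwedge_{k=1}^{N-1}\boldsymbol\tau_{i,k}(\boldsymbol\theta_{i*})$ of $\mathcal S_i$ at $\mathbf u_*=\mathbf U_i(\boldsymbol\theta_{i*})$ is inward-pointing, i.e. directed towards the interior of $G$.
   Formalization: Each parameter set Θ_i is assumed to lie in the closure of its interior (and U_i to be C¹ near its points), since on an arbitrary Θ_i, e.g. one with isolated points, the derivatives ∂U_i/∂θ are not determined by U_i and their cross product need not be normal to S_i. *)

(* Defs.v *)
From HB Require Import structures.
From mathcomp Require Import all_boot all_order all_algebra.
From mathcomp Require Import all_classical all_reals all_analysis.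

Set Implicit Arguments.
Unset Strict Implicit.
Unset Printing Implicit Defensive.

Import Order.TTheory GRing.Theory Num.Theory.
Import numFieldNormedType.Exports.
Local Open Scope classical_set_scope.
Local Open Scope ring_scope.

Definition boundary (T : topologicalType) (A : set T) : set T :=
  closure A `\` interior A.

Definition dotv (R : realType) (N : nat) (u v : 'rV[R]_N) : R :=
  \sum_j u 0 j * v 0 j.

Definition partial (R : realType) (N : nat) (W : normedModType R)
    (f : 'rV[R]_N -> W) (i : 'I_N) (x : 'rV[R]_N) : W :=
  'D_(delta_mx 0 i) f x.

Definition grad (R : realType) (N : nat) (f : 'rV[R]_N -> R) (x : 'rV[R]_N)
  : 'rV[R]_N := \row_j partial f j x.

(* f is continuously differentiable at the point x: it is differentiable near
   x, and its derivative is continuous at x.  On an open set, being C1 at each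
   point is the usual class C1. *)
Definition C1_at (R : realType) (N : nat) (W : normedModType R)
    (f : 'rV[R]_N -> W) (x : 'rV[R]_N) : Prop :=
  (\forall y \near x, differentiable f y) /\
  (forall i, {for x, continuous (partial f i)}).

(* f = 0 is a local equation of S at p: near p, f is C1 with nonzero gradient
   at p and S is a subset of the zero set of f.  S need not fill that zero set
   around p, so that p may be an edge or corner point of the piece S (as for
   the faces of a polytope), but p is a limit of points around which S does. *)
Definition local_equation (R : realType) (N : nat) (S : set 'rV[R]_N)
    (p : 'rV[R]_N) (f : 'rV[R]_N -> R) : Prop :=
  [/\ \forall x \near p, C1_at f x,
      grad f p != 0,
      \forall x \near p, S x -> f x = 0 &
      closure [set q | f q = 0 /\ \forall x \near q, f x = 0 -> S x] p].

Definition C1_hypersurface (R : realType) (N : nat) (S : set 'rV[R]_N) : Prop :=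
  forall p, S p -> exists f, local_equation S p f.

Definition normal_vector (R : realType) (N : nat) (S : set 'rV[R]_N)
    (p n : 'rV[R]_N) : Prop :=
  n != 0 /\ exists f (c : R), local_equation S p f /\ n = c *: grad f p.

(* n, attached at p, points to the side of the hyperplane (u - p) . n = 0 on
   which the interior of G has a point.  The stronger requirements "p + t n is
   in the interior of G for small t > 0" (which fails at acute corners) and
   "all of the interior of G lies on the side of n" imply this one. *)
Definition inward_pointing (R : realType) (N : nat) (G : set 'rV[R]_N)
    (p n : 'rV[R]_N) : Prop :=
  exists2 u, (interior G) u & 0 < dotv (u - p) n.

Section Constraints.
Context (R : realType) (N I : nat).
(* [strict] is the set of the indices of the constraints g i u > 0; the
   constraints of the other indices are g i u >= 0. *)
Variables (strict : {set 'I_I}) (g : 'I_I -> 'rV[R]_N -> R).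

Definition succ0 (i : 'I_I) (x : R) : Prop := 0 < x ?<= if (i \notin strict).

Definition Gi (i : 'I_I) : set 'rV[R]_N := [set u | succ0 i (g i u)].

Definition Gset : set 'rV[R]_N := [set u | forall i, succ0 i (g i u)].

Definition Si (i : 'I_I) : set 'rV[R]_N := boundary Gset `&` boundary (Gi i).

Definition piecewise_C1_boundary : Prop :=
  [/\ boundary Gset = \bigcup_i Si i,
      forall i, C1_hypersurface (Si i) &
      forall i u, Si i u -> C1_at (g i) u].

End Constraints.

(* The square matrix with rows tau_1, ..., tau_n, x. *)
Definition rows_then (R : realType) (n : nat) (tau : 'I_n -> 'rV[R]_n.+1)
    (x : 'rV[R]_n.+1) : 'M[R]_n.+1 :=
  \matrix_(k < n.+1) oapp tau x (unlift ord_max k).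

(* Generalized cross product of n vectors of R^(n+1). *)
Definition cross (R : realType) (n : nat) (tau : 'I_n -> 'rV[R]_n.+1)
  : 'rV[R]_n.+1 := \row_j \det (rows_then tau (delta_mx 0 j)).

Lemma dotv_cross (R : realType) (n : nat) (tau : 'I_n -> 'rV[R]_n.+1)
    (x : 'rV[R]_n.+1) :
  dotv (cross tau) x = \det (rows_then tau x).
Proof.
have cof j y z : cofactor (rows_then tau y) ord_max j =
                 cofactor (rows_then tau z) ord_max j.
  congr (_ * \det _); apply/matrixP => a b.
  by rewrite !mxE liftK.
rewrite (expand_det_row _ ord_max); apply: eq_bigr => j _.
rewrite !mxE unlift_none /= mulrC; congr (_ * _).
rewrite (expand_det_row _ ord_max) (bigD1 j) //= big1 ?addr0 => [|k kj].
  by rewrite !mxE unlift_none /= mxE !eqxx mul1r; apply: cof.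
by rewrite !mxE unlift_none /= mxE (negbTE kj) andbF mul0r.
Qed.

Lemma cross_unique (R : realType) (n : nat) (tau : 'I_n -> 'rV[R]_n.+1)
    (w : 'rV[R]_n.+1) :
  (forall x, dotv w x = \det (rows_then tau x)) -> w = cross tau.
Proof.
move=> wP; apply/rowP => j; rewrite mxE -wP /dotv (bigD1 j) //= big1.
  by rewrite mxE !eqxx mulr1 addr0.
by move=> k kj; rewrite mxE (negbTE kj) andbF mulr0.
Qed.

(* U, as a C1 function on Theta, parametrizes S.  Theta is not assumed open:
   U is a total function, C1 at the points of Theta, and Theta lies in the
   closure of its interior, without which the partial derivatives at the points
   of Theta would not be determined by the restriction of U to Theta. *)
Definition C1_parametrization (R : realType) (n N : nat) (S : set 'rV[R]_N)
    (Theta : set 'rV[R]_n) (U : 'rV[R]_n -> 'rV[R]_N) : Prop :=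
  [/\ Theta `<=` closure (interior Theta),
      forall theta, Theta theta -> C1_at U theta &
      S = U @` Theta].

Definition tangent_cross (R : realType) (n : nat)
    (U : 'rV[R]_n -> 'rV[R]_n.+1) (theta : 'rV[R]_n) : 'rV[R]_n.+1 :=
  cross (fun k => partial U k theta).

Definition phi (R : realType) (n : nat) (U : 'rV[R]_n -> 'rV[R]_n.+1)
    (delta : 'rV[R]_n -> R) (u : 'rV[R]_n.+1) (theta : 'rV[R]_n) : R :=
  dotv (u - U theta) (delta theta *: tangent_cross U theta).

Definition Gstar (R : realType) (n I : nat) (strict : {set 'I_I})
    (Theta : 'I_I -> set 'rV[R]_n) (U : 'I_I -> 'rV[R]_n -> 'rV[R]_n.+1)
    (delta : 'I_I -> 'rV[R]_n -> R) : set 'rV[R]_n.+1 :=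
  [set u | forall i theta, Theta i theta ->
     succ0 strict i (phi (U i) (delta i) u theta)].

(* Main.v *)
Require Import Defs.
From HB Require Import structures.
From mathcomp Require Import all_boot all_order all_algebra.
From mathcomp Require Import all_classical all_reals all_analysis.
From mathcomp Require Import ring lra.

Import Order.TTheory GRing.Theory Num.Theory.
Import numFieldNormedType.Exports.
Local Open Scope classical_set_scope.
Local Open Scope ring_scope.

(** The tangent hyperplane of a smooth piece of the boundary of a convex set G
    supports G. Let q be a boundary point of G around which the zero set of f
    lies in the closure of G, with nonzero gradient of f at q. If the tangent
    hyperplane at q contained an interior point w, then, starting from q and
    moving a little in the direction q - w, the zero set of f would be met at
    a point of the form q + h (s n - (w - q)) with n the gradient and s small.
    That point is in the closure of G, and q lies strictly between it and the
    interior point w - s n, so q would be interior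
    ([tangent_hyperplane_avoids_interior]). Hence any two interior points of G
    lie on the same side of the tangent hyperplane at q; this closed condition
    passes to the limit points p of such points q, which are all the points of
    a hypersurface ([tangent_same_side]). So an inward-pointing normal vector
    at p is positive on the whole interior ([inward_normal_supporting]) and
    nonnegative on the closure ([closure_halfspace]).

    The generalized cross product of the tangent vectors is such a normal
    vector up to a factor: differentiating f o U = 0 shows that the gradient
    is orthogonal to the n tangent vectors, and a nonzero cross product spans
    the line orthogonal to them ([grad_tangent_cross]).

    Therefore phi_i >= 0 on the closure of G, and at a point of G equality for
    a strict index is excluded by the hypothesis on tangent hyperplanes; this
    gives the inclusion of G in G_*. Conversely let u be outside G. If u is in
    the closure of G, it violates some constraint i, which must be strict as
    the other G_i are closed; then u is on S_i, where one of the phi_i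
    vanishes. If u is outside the closure, the segment from an interior point
    to u crosses the boundary at some U_i(theta), where the affine function
    phi_i(.; theta) vanishes; being positive at the interior end, it is
    negative at u. *)

(** * Interior and boundary of convex sets *)

Lemma convex_set_combination {R : realType} {V : normedModType R} {A : set V}
    {x y : V} {t : R} :
  convex_set A -> A x -> A y -> 0 <= t <= 1 -> A ((1 - t) *: x + t *: y).
Proof.
move=> cA Ax Ay /andP[t0 t1].
have := cA y x (Itv01 t0 t1); rewrite !inE => /(_ Ay Ax).
by rewrite addrC.
Qed.

(** For x in A the point is interior because A contains the homothetic image,
    centred at x, of a neighbourhood of w.  A point x of the closure is first
    replaced by a point x' of A so close that the homothety of centre x' and
    ratio t still pulls the given point back into the interior. *)
Lemma interior_convex_combination {R : realType} {V : normedModType R}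
    {A : set V} {x w : V} {t : R} :
  convex_set A -> closure A x -> interior A w -> 0 < t <= 1 ->
  interior A ((1 - t) *: x + t *: w).
Proof.
move=> cA Ax Aw /andP[t0 t1]; set y := _ + _.
have tN0 : t != 0 by rewrite gt_eqF.
have homothety_cont (b : V) :
    continuous (fun z : V => t^-1 *: (b - (1 - t) *: z)).
  move=> z; apply: cvgZl_tmp; apply: cvgB; first exact: cvg_cst.
  by apply: cvgZl_tmp.
have y_x : t^-1 *: (y - (1 - t) *: x) = w.
  by rewrite /y addrAC subrr add0r scalerA mulVf // scale1r.
have near_x : \forall x' \near x, interior A (t^-1 *: (y - (1 - t) *: x')).
  apply: homothety_cont => //; rewrite y_x.
  exact: nbhs_interior.
have [x' [Ax' Aw']] := Ax _ near_x.
have near_y : \forall z \near y, A (t^-1 *: (z - (1 - t) *: x')).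
  have k : {for y, continuous (fun z : V => t^-1 *: (z - (1 - t) *: x'))}.
    by apply: cvgZl_tmp; apply: cvgB => //; exact: cvg_cst.
  exact: k.
apply: filterS near_y => z Az.
have := convex_set_combination (t := t) cA Ax' Az.
rewrite scalerA divff // scale1r addrC subrK; apply.
by rewrite ltW.
Qed.

Lemma interior_segment_around {R : realType} {V : normedModType R}
    {A : set V} {w : V} (v : V) :
  interior A w ->
  exists2 e : R, 0 < e & forall s, `|s| <= e -> interior A (w - s *: v).
Proof.
move=> Aw; have cont : {for 0 : R, continuous (fun s : R => w - s *: v)}.
  by apply: cvgB; [exact: cvg_cst|apply: cvgZr_tmp].
have : \forall s \near (0 : R), interior A (w - s *: v).
  by apply: cont; rewrite scale0r subr0; exact: nbhs_interior.
move=> /(@nbhs_norm0P R R^o)[e /= e0 eA]; exists (e / 2).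
  by rewrite divr_gt0.
move=> s se; apply: eA => /=.
by rewrite (le_lt_trans se) // ltr_pdivrMr // ltr_pMr // ltr1n.
Qed.

Lemma subl_continuous {R : realType} {V : normedModType R} (x : V) :
  continuous (fun y : V => x - y).
Proof. by move=> y; apply: cvgB; [exact: cvg_cst|exact: cvg_id]. Qed.

(** If the segment avoided the boundary, the part of it in the interior of A
    would be both open and closed in it, hence the whole segment. *)
Lemma boundary_crossing {R : realType} {V : normedModType R}
    {A : set V} {x y : V} :
  interior A x -> ~ closure A y ->
  exists2 t : R, 0 < t < 1 & boundary A (x + t *: (y - x)).
Proof.
move=> Ax Ay; apply: contrapT => nocross.
pose l (t : R) := x + t *: (y - x).
have l0 : l 0 = x by rewrite /l scale0r addr0.
have l1 : l 1 = y by rewrite /l scale1r addrC subrK.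
have lcont : continuous l.
  by move=> t; apply: cvgD; [exact: cvg_cst|apply: cvgZr_tmp].
have in01 : `[0, 1]%classic `&` l @^-1` (closure A) =
            `[0, 1]%classic `&` l @^-1` (interior A).
  apply/seteqP; split=> t [t01 At]; split=> //; last first.
    by apply: subset_closure; exact: interior_subset At.
  apply: contrapT => nAt; apply: nocross; exists t; last by [].
  move: t01; rewrite /= in_itv /= => /andP[t0 t1].
  rewrite lt_neqAle t0 lt_neqAle t1 !andbT; apply/andP; split.
    by apply/eqP => t_0; apply: nAt; rewrite /preimage /= -t_0 l0.
  by apply/eqP => t_1; apply: Ay; rewrite -l1 -t_1.
have : `[0, 1]%classic `&` l @^-1` (interior A) = `[0, 1]%classic.
  apply: (@segment_connected R 0 1).
  - by exists 0; split; rewrite /= ?in_itv /= ?lexx ?ler01 // l0.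
  - exists (l @^-1` (interior A)) => //.
    by apply: open_comp => //; exact: open_interior.
  - exists (l @^-1` (closure A)) => //.
    by apply: closed_comp => //; exact: closed_closure.
move/seteqP => [_ /(_ 1)] /=; rewrite in_itv /= ler01 lexx => /(_ isT)[_].
by rewrite l1 => /interior_subset /subset_closure.
Qed.

(** * Limits along the points of a set *)

(** Transfers a closed condition from the regular points of a hypersurface, or
    from the interior of a parameter domain, to the limits of such points. *)
Lemma closure_limit {T X : topologicalType} {h : T -> X} {C : set X}
    {Q : set T} {p : T} :
  closed C -> {for p, continuous h} -> closure Q p ->
  (\forall x \near p, Q x -> C (h x)) -> C (h p).
Proof.
move=> Ccl hcont Qp QC; apply: Ccl => B /hcont hB.
have [x [Qx [QCx Bx]]] := Qp _ (filterI QC hB).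
by exists (h x); split=> //; exact: QCx.
Qed.

(** * Tangent hyperplanes at regular boundary points *)

Lemma derive_gt0_near_right {R : realType} {V : normedModType R} {f : V -> R}
    {q v : V} :
  differentiable f q -> f q = 0 -> 0 < 'D_v f q ->
  \forall h \near 0^'+, 0 < f (q + h *: v).
Proof.
move=> df fq0 Dv.
have : derivable f q v by apply: diff_derivable.
move=> /cvg_ex[l lP]; have Dl : 'D_v f q = l by apply: cvg_lim lP.
rewrite Dl in Dv.
have /cvg_dnbhs_at_right hr := lP.
near=> h.
have h0 : 0 < h by [].
have : 0 < h^-1 *: ((f \o shift q) (h *: v) - f q).
  by near: h; exact: (cvgr_gt _ hr).
rewrite /= fq0 subr0 /GRing.scale /= pmulr_rgt0 ?invr_gt0 //.
by rewrite addrC.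
Unshelve. all: by end_near. Qed.

(** Suppose that the hyperplane contains an interior point w; let d = w - q and
    take v with positive derivative of f at q along v. Then the derivative
    along s v - d has the sign of s, so for small h > 0 some s in [-e, e]
    makes q + h (s v - d) a zero of f, that is, a point of the closure of A.
    As q is the combination of this point and w - s v with weights proportional
    to 1 and h, it would be interior. *)
Lemma tangent_hyperplane_avoids_interior {R : realType} {V : normedModType R}
    {A : set V} {f : V -> R} {q v w : V} :
  convex_set A -> ~ interior A q ->
  f q = 0 -> 'd f q v != 0 ->
  (\forall x \near q, differentiable f x) ->
  (\forall x \near q, f x = 0 -> closure A x) ->
  interior A w -> 'd f q (w - q) != 0.
Proof.
move=> cA Aq fq0.
wlog dv : v / 0 < 'd f q v.
  move=> wl dv0; have := dv0; rewrite neq_lt => /orP[dneg|dpos].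
    by apply: (wl (- v)); rewrite linearN ?oppr_gt0 ?oppr_eq0.
  exact: (wl v).
move=> _ dfn zeros Aw; apply/eqP => dw.
have df : differentiable f q by exact: nbhs_singleton dfn.
pose d := w - q.
have [e e0 eA] := interior_segment_around v Aw.
have [r r0 rP] : exists2 r : R, 0 < r & forall x, `|q - x| < r ->
    differentiable f x /\ (f x = 0 -> closure A x).
  have : \forall x \near q, differentiable f x /\ (f x = 0 -> closure A x).
    exact: filterI.
  by rewrite nbhs_normP => -[r /= r0 rP]; exists r => // x /rP.
pose g (h s : R) := q + h *: (s *: v - d).
have Dg s : 'D_(s *: v - d) f q = s * 'd f q v.
  by rewrite deriveE // linearB linearZ /= dw subr0.
have gpos : \forall h \near 0^'+, 0 < f (g h e).
  by apply: derive_gt0_near_right => //; rewrite Dg mulr_gt0.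
have gneg : \forall h \near 0^'+, 0 < - f (g h (- e)).
  apply: (@derive_gt0_near_right _ _ (- f)) => //.
  - exact: differentiableN.
  - by rewrite /GRing.opp /= fq0 oppr0.
  - rewrite deriveN; last exact: diff_derivable.
    by rewrite Dg mulNr opprK mulr_gt0.
(* M bounds the norm of s v - d for s in [-e, e]; the 1 makes it positive. *)
pose M := `|d| + e * `|v| + 1.
have M0 : 0 < M by rewrite ltr_wpDl // addr_ge0 // mulr_ge0 // ltW.
have [h [h0 hM fpos fneg]] : exists h : R,
    [/\ 0 < h, h < r / M, 0 < f (g h e) & 0 < - f (g h (- e))].
  near (0 : R)^'+ => h; exists h; split.
  - by [].
  - by near: h; apply: nbhs_right_lt; rewrite divr_gt0.
  - by near: h.
  - by near: h.
have near_g s : `|s| <= e -> `|q - g h s| < r.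
  move=> se; rewrite /g opprD addNKr normrN normrZ gtr0_norm //.
  rewrite ltr_pdivlMr // in hM; apply: le_lt_trans hM.
  rewrite ler_wpM2l ?(ltW h0) // (le_trans (ler_normB _ _)) //.
  rewrite normrZ /M addrC -addrA lerD2l (le_trans (ler_wpM2r _ se)) //.
  by rewrite lerDl.
have [s] : exists2 s, s \in `[- e, e] & f (g h s) = 0.
  apply: IVT.
  - by rewrite ge0_cp // ltW.
  - apply: continuous_in_subspaceT => s.
    rewrite inE /= in_itv /= -ler_norml => se.
    apply: continuous_comp.
      apply: cvgD; first exact: cvg_cst.
      apply: cvgZl_tmp; apply: cvgB; last exact: cvg_cst.
      by apply: cvgZr_tmp.
    by apply: differentiable_continuous; have [] := rP _ (near_g _ se).
  - rewrite ge_min le_max; rewrite oppr_gt0 in fneg.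
    by rewrite (ltW fneg) (ltW fpos) orbT.
rewrite in_itv /= -ler_norml => se fs0.
have Ax : closure A (g h s) by have [_] := rP _ (near_g _ se); exact.
apply: Aq.
have h1 : 0 < 1 + h by rewrite addr_gt0.
have -> : q = (1 - h / (1 + h)) *: g h s + (h / (1 + h)) *: (w - s *: v).
  have -> : 1 - h / (1 + h) = (1 + h)^-1 by field; lra.
  rewrite [h / _]mulrC -scalerA -scalerDr.
  apply: (scalerI (lt0r_neq0 h1)); rewrite scalerA divff ?lt0r_neq0 // scale1r.
  rewrite /g /d scalerDl scale1r -addrA -scalerDr; congr (_ + _ *: _).
  by rewrite opprB [RHS]addrC addrA subrK addrC subrK.
apply: interior_convex_combination => //; first exact: eA.
by rewrite divr_gt0 //= ler_pdivrMr // mul1r lerDr.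
Unshelve. all: by end_near. Qed.

(** * The dot product and the gradient *)

Section DotProduct.
Context {R : realType} {N : nat}.
Implicit Types (u v w : 'rV[R]_N) (a : R).

Lemma dotvC u v : dotv u v = dotv v u.
Proof. by apply: eq_bigr => j _; rewrite mulrC. Qed.

Lemma dotvDl u v w : dotv (u + v) w = dotv u w + dotv v w.
Proof. by rewrite -big_split; apply: eq_bigr => j _; rewrite mxE mulrDl. Qed.

Lemma dotvZl a u v : dotv (a *: u) v = a * dotv u v.
Proof.
by rewrite /dotv mulr_sumr; apply: eq_bigr => j _; rewrite mxE mulrA.
Qed.

Lemma dotvZr a u v : dotv u (a *: v) = a * dotv u v.
Proof. by rewrite dotvC dotvZl dotvC. Qed.

Lemma dotvBl u v w : dotv (u - v) w = dotv u w - dotv v w.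
Proof. by rewrite dotvDl -scaleN1r dotvZl mulN1r. Qed.

Lemma dotv0l u : dotv 0 u = 0.
Proof. by rewrite -(scale0r 0) dotvZl mul0r. Qed.

Lemma dotvv_gt0 {u} : u != 0 -> 0 < dotv u u.
Proof.
move=> u0; have [j uj] : exists j, u 0 j != 0.
  apply/existsP; apply: contraNT u0 => /existsPn u0; apply/eqP/rowP => j.
  by rewrite mxE; apply/eqP; rewrite -[_ == _]negbK.
rewrite /dotv (bigD1 j) //= ltr_pwDl //.
  by rewrite lt_neqAle -expr2 sqr_ge0 eq_sym sqrf_eq0 uj.
by apply: sumr_ge0 => k _; rewrite -expr2 sqr_ge0.
Qed.

Lemma dotv_continuous {T : topologicalType} (a b : T -> 'rV[R]_N) (x : T) :
  (forall j, {for x, continuous (fun y => a y 0 j)}) ->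
  (forall j, {for x, continuous (fun y => b y 0 j)}) ->
  {for x, continuous (fun y => dotv (a y) (b y))}.
Proof.
move=> ca cb.
apply: (@cvg_big R^o _ +%R 0 xpredT (@add_continuous R^o) T (nbhs x) _
  (fun j y => a y 0 j * b y 0 j)) => j _.
by apply: cvgM; [exact: ca|exact: cb].
Qed.

Lemma diff_dotv_grad {f : 'rV[R]_N -> R} {x : 'rV[R]_N} v :
  differentiable f x -> 'd f x v = dotv v (grad f x).
Proof.
move=> df; rewrite [v in LHS]row_sum_delta linear_sum; apply: eq_bigr => j _.
by rewrite linearZ /= mxE /partial deriveE.
Qed.

Lemma coord_diff_continuous {T : topologicalType} {a : T -> 'rV[R]_N} {x : T}
    (j : 'I_N) :
  {for x, continuous a} -> {for x, continuous (fun y => a y 0 j)}.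
Proof.
move=> ca; exact: (continuous_comp ca (@coord_continuous _ _ _ 0 j (a x))).
Qed.

End DotProduct.

(** * The generalized cross product *)

(** The determinant has two equal rows. *)
Lemma cross_orthogonal {R : realType} {n : nat} (tau : 'I_n -> 'rV[R]_n.+1) k :
  dotv (cross tau) (tau k) = 0.
Proof.
rewrite dotv_cross.
apply: (@determinant_alternate _ _ _ (lift ord_max k) ord_max).
  by rewrite eq_sym neq_lift.
by move=> j; rewrite !mxE liftK unlift_none.
Qed.

(** With w the cross product, the matrix of rows tau_1, ..., tau_n, w has
    determinant w . w, which is nonzero; so a vector orthogonal to all its rows
    vanishes.  Apply this to the component of v orthogonal to w. *)
Lemma orthogonal_colinear_cross {R : realType} {n : nat}
    {tau : 'I_n -> 'rV[R]_n.+1} {v : 'rV[R]_n.+1} :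
  cross tau != 0 -> (forall k, dotv v (tau k) = 0) ->
  exists a, v = a *: cross tau.
Proof.
set w := cross tau => w0 vtau; exists (dotv v w / dotv w w).
have ww : dotv w w != 0 by rewrite gt_eqF ?dotvv_gt0.
apply/eqP; rewrite -subr_eq0; set z := _ - _.
pose M := rows_then tau w.
have Munit : M^T \in unitmx.
  by rewrite unitmx_tr unitmxE unitfE -dotv_cross.
have rowM k : dotv z (row k M) = 0.
  case: (unliftP ord_max k) => [i ->|->].
    have -> : row (lift ord_max i) M = tau i.
      by apply/rowP => j; rewrite !mxE liftK.
    by rewrite dotvBl dotvZl vtau cross_orthogonal mulr0 subrr.
  have -> : row ord_max M = w.
    by apply/rowP => j; rewrite /row /M /rows_then mxE mxE unlift_none.
  by rewrite dotvBl dotvZl divfK // subrr.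
have zM : z *m M^T = 0.
  apply/rowP => k; rewrite !mxE -[RHS](rowM k).
  by apply: eq_bigr => j _; rewrite !mxE.
by rewrite -(mulmxK Munit z) zM mul0mx.
Qed.

(** * Supporting hyperplanes *)

Lemma interior_meets_hyperplane {R : realType} {N : nat} {A : set 'rV[R]_N}
    {q m x w : 'rV[R]_N} :
  convex_set A -> closure A x -> interior A w ->
  dotv (x - q) m < 0 -> 0 < dotv (w - q) m ->
  exists2 v, interior A v & dotv (v - q) m = 0.
Proof.
move=> cA Ax Aw; set a := dotv _ _ => a0; set b := dotv _ _ => b0.
have ba : 0 < b - a by rewrite subr_gt0 (lt_trans a0).
have t01 : 0 < - a / (b - a) <= 1.
  by rewrite divr_gt0 ?oppr_gt0 //= ler_pdivrMr // mul1r lerDr ltW.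
exists ((1 - - a / (b - a)) *: x + (- a / (b - a)) *: w).
  exact: interior_convex_combination.
rewrite dotvBl dotvDl !dotvZl.
have -> : dotv x m = a + dotv q m by rewrite /a dotvBl subrK.
have -> : dotv w m = b + dotv q m by rewrite /b dotvBl subrK.
by field; rewrite gt_eqF.
Qed.

Lemma closure_halfspace {R : realType} {N : nat} {A : set 'rV[R]_N}
    {p n x : 'rV[R]_N} :
  convex_set A -> interior A !=set0 ->
  (forall u, interior A u -> 0 < dotv (u - p) n) ->
  closure A x -> 0 <= dotv (x - p) n.
Proof.
move=> cA [w Aw] pos Ax; rewrite leNgt; apply/negP => neg.
have [v Av v0] := interior_meets_hyperplane cA Ax Aw neg (pos _ Aw).
by have := pos _ Av; rewrite v0 ltxx.
Qed.

(** Being on the same side is expressed by the sign of a product, so that it is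
    a closed condition on q and m, whatever the side. *)
Lemma convex_same_side {R : realType} {N : nat} {A : set 'rV[R]_N}
    {q m u v : 'rV[R]_N} :
  convex_set A -> (forall w, interior A w -> dotv (w - q) m != 0) ->
  interior A u -> interior A v ->
  0 <= dotv (u - q) m * dotv (v - q) m.
Proof.
move=> cA avoid Au Av; rewrite leNgt; apply/negP => opp.
wlog [u0 v0] : u v Au Av opp / dotv (u - q) m < 0 /\ 0 < dotv (v - q) m.
  move=> wl; have [u0|u0|u0] := ltgtP (dotv (u - q) m) 0.
  - by apply: (wl u v) => //; split=> //; move: opp; rewrite nmulr_rlt0.
  - apply: (wl v u) => //; first by rewrite mulrC.
    by split=> //; move: opp; rewrite pmulr_rlt0.
  - by move: opp; rewrite u0 mul0r ltxx.
have [w Aw /eqP] := interior_meets_hyperplane cA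
  (subset_closure (interior_subset Au)) Av u0 v0.
exact/negP/avoid.
Qed.

(** Holds at the points around which S fills the zero set of f, by
    [tangent_hyperplane_avoids_interior], and these accumulate at p. *)
Lemma tangent_same_side {R : realType} {N : nat} {A S : set 'rV[R]_N}
    {p u v : 'rV[R]_N} {f : 'rV[R]_N -> R} :
  convex_set A -> S `<=` boundary A ->
  local_equation S p f -> interior A u -> interior A v ->
  0 <= dotv (u - p) (grad f p) * dotv (v - p) (grad f p).
Proof.
move=> A_convex S_boundary [fC1 grad0 _ Sp] Au Av.
have [dfn gradC] := nbhs_singleton fC1.
have grad_cont j : {for p, continuous (fun q : 'rV[R]_N => grad f q 0 j)}.
  rewrite (_ : (fun _ => _) = partial f j); first exact: gradC.
  by apply/funext => q; rewrite mxE.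
have side_cont (x : 'rV[R]_N) :
    {for p, continuous (fun q : 'rV[R]_N => dotv (x - q) (grad f q))}.
  apply: (dotv_continuous (T := 'rV[R]_N)) => // j.
  exact: (coord_diff_continuous (T := 'rV[R]_N)) (subl_continuous x p).
pose h (q : 'rV[R]_N) : R := dotv (u - q) (grad f q) * dotv (v - q) (grad f q).
have h_cont : {for p, continuous h}.
  exact: (cvgM (side_cont u) (side_cont v)).
apply: (@closure_limit 'rV[R]_N R h _ _ p (@closed_ge R 0) h_cont Sp).
have grad_neq0 : \forall q \near p, grad f q != 0.
  have c : {for p, continuous (fun q : 'rV[R]_N => dotv (grad f q) (grad f q))}.
    exact: dotv_continuous.
  have grad_pos : \forall q \near p, 0 < dotv (grad f q) (grad f q).
    exact: (cvgr_gt _ c _ (dotvv_gt0 grad0)).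
  near=> q; have : 0 < dotv (grad f q) (grad f q) by near: q.
  by apply: contraTneq => ->; rewrite dotv0l ltxx.
near=> q => -[fq0 qS] /=.
have dfq : \forall x \near q, differentiable f x.
  by have [] : C1_at f q by near: q.
have df := nbhs_singleton dfq.
have Sq : S q by exact: nbhs_singleton qS fq0.
apply: (convex_same_side A_convex _ Au Av) => w Aw.
rewrite -diff_dotv_grad //.
have grad_q : 'd f q (grad f q) != 0.
  by rewrite diff_dotv_grad // gt_eqF // dotvv_gt0 //; near: q.
have zeros : \forall x \near q, f x = 0 -> closure A x.
  by apply: filterS qS => x xS /xS /S_boundary[].
have [_ Aq] := S_boundary _ Sq.
exact: (tangent_hyperplane_avoids_interior A_convex Aq fq0 grad_q dfq zeros Aw).
Unshelve. all: by end_near. Qed.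

(** The interior is open, so a zero of (u - p) . n at an interior point u
    would give negative values at the nearby points u - e n. *)
Lemma inward_normal_supporting {R : realType} {N : nat} {A S : set 'rV[R]_N}
    {p n u : 'rV[R]_N} {f : 'rV[R]_N -> R} {c : R} :
  convex_set A -> S `<=` boundary A ->
  local_equation S p f -> n = c *: grad f p -> inward_pointing A p n ->
  interior A u -> 0 < dotv (u - p) n.
Proof.
move=> A_convex S_boundary eqf nE [u0 Au0 u0n] Au.
have ge0 v : interior A v -> 0 <= dotv (v - p) n.
  move=> Av; rewrite -(pmulr_rge0 _ u0n) nE !dotvZr mulrACA.
  rewrite mulr_ge0 -?expr2 ?sqr_ge0 //.
  exact: (tangent_same_side A_convex S_boundary eqf).
have n0 : n != 0 by apply: contraTneq u0n => ->; rewrite dotvC dotv0l ltxx.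
have [e e0 /(_ e)] := interior_segment_around n Au.
rewrite gtr0_norm // lexx => /(_ isT) Ae.
have := ge0 _ Ae.
rewrite addrAC [dotv (_ - _ *: _) _]dotvBl dotvZl subr_ge0; apply: lt_le_trans.
by rewrite mulr_gt0 // dotvv_gt0.
Qed.

(** * Parametrized hypersurfaces *)

(** At the interior points y of Theta, differentiate f o U = 0; the points of
    Theta are limits of such points y. *)
Lemma tangent_orthogonal_grad {R : realType} {d N : nat} {S : set 'rV[R]_N}
    {Theta : set 'rV[R]_d} {U : 'rV[R]_d -> 'rV[R]_N} {theta : 'rV[R]_d}
    {f : 'rV[R]_N -> R} (k : 'I_d) :
  C1_parametrization S Theta U -> Theta theta ->
  local_equation S (U theta) f ->
  dotv (grad f (U theta)) (partial U k theta) = 0.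
Proof.
move=> [Thetacl UC1 SE] Ttheta [fC1 _ Sf0 _].
have [dU UpC] := UC1 _ Ttheta.
have Ucont : {for theta, continuous U}.
  by apply: differentiable_continuous; exact: nbhs_singleton dU.
have [dfn gradC] := nbhs_singleton fC1.
pose h (y : 'rV[R]_d) : R := dotv (grad f (U y)) (partial U k y).
have h_cont : {for theta, continuous h}.
  apply: (dotv_continuous (T := 'rV[R]_d)) => j.
    rewrite (_ : (fun _ => _) = partial f j \o U).
      exact: (continuous_comp Ucont (gradC j)).
    by apply/funext => y; rewrite mxE.
  exact: (coord_diff_continuous (T := 'rV[R]_d)) (UpC k).
apply: (@closure_limit 'rV[R]_d R h _ _ theta (@closed_eq R 0) h_cont
  (Thetacl _ Ttheta)).
near=> y => /= Ty.
have dUy : differentiable U y by near: y.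
have dfy : differentiable f (U y) by near: y; exact: Ucont _ dfn.
have fU0 : \forall z \near y, f (U z) = 0.
  have : \forall z \near y, S (U z) -> f (U z) = 0.
    by near: y; exact: (near_join (Ucont _ Sf0)).
  apply: filterS2 Ty => z Tz; apply.
  by rewrite SE; exists z.
have : 'D_(delta_mx 0 k) (f \o U) y = 0.
  by rewrite -[RHS](derive_cst (0 : R) y (delta_mx 0 k)); exact: near_eq_derive.
have dfU : differentiable (f \o U) y by exact: differentiable_comp.
rewrite deriveE // diff_comp //= diff_dotv_grad // dotvC => <-.
by rewrite /h /partial deriveE.
Unshelve. all: by end_near. Qed.

Lemma grad_tangent_cross {R : realType} {n : nat}
    {S : set 'rV[R]_n.+1} {Theta : set 'rV[R]_n}
    {U : 'rV[R]_n -> 'rV[R]_n.+1} {theta : 'rV[R]_n} {f : 'rV[R]_n.+1 -> R} :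
  C1_parametrization S Theta U -> Theta theta ->
  tangent_cross U theta != 0 -> local_equation S (U theta) f ->
  exists2 a, a != 0 & grad f (U theta) = a *: tangent_cross U theta.
Proof.
move=> Uparam Ttheta cross0 eqf.
have [a aE] := orthogonal_colinear_cross cross0
  (fun k => tangent_orthogonal_grad k Uparam Ttheta eqf).
exists a => //; case: eqf => _ + _ _; apply: contraNneq => a0.
by rewrite aE a0 scale0r.
Qed.

(** * The two descriptions of G *)

Theorem theorem4p2 (R : realType) (n I : nat) (strict : {set 'I_I})
    (g : 'I_I -> 'rV[R]_n.+1 -> R)
    (nrm : 'I_I -> 'rV[R]_n.+1 -> 'rV[R]_n.+1)
    (Theta : 'I_I -> set 'rV[R]_n)
    (U : 'I_I -> 'rV[R]_n -> 'rV[R]_n.+1)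
    (delta : 'I_I -> 'rV[R]_n -> R)
    (Gi_open : forall i, i \in strict -> open (Gi strict g i))
    (Gi_closed : forall i, i \notin strict -> closed (Gi strict g i))
    (G_convex : convex_set (Gset strict g))
    (G_interior : interior (Gset strict g) !=set0)
    (G_boundary : piecewise_C1_boundary strict g)
    (nrm_normal : forall i u, i \in strict -> Si strict g i u ->
       normal_vector (Si strict g i) u (nrm i u) /\
       inward_pointing (Gset strict g) u (nrm i u))
    (G_tangent : forall i, i \in strict ->
       Gset strict g `&`
         \bigcup_(us in Si strict g i) [set u | dotv (u - us) (nrm i us) = 0]
       = set0)
    (S_param : forall i, C1_parametrization (Si strict g i) (Theta i) (U i))
    (cross_neq0 : forall i theta, Theta i theta ->
       tangent_cross (U i) theta != 0)
    (delta_inward : forall i theta, Theta i theta ->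
       delta i theta != 0 /\
       inward_pointing (Gset strict g) (U i theta)
         (delta i theta *: tangent_cross (U i) theta)) :
  Gset strict g = Gstar strict Theta U delta /\
  (forall i theta, Theta i theta ->
     exists (L : {linear 'rV[R]_n.+1 -> R^o}) (c : R),
       forall u, phi (U i) (delta i) u theta = L u + c).
Proof.
split; last first.
  move=> i theta _; set m := delta i theta *: tangent_cross (U i) theta.
  pose l : 'rV[R]_n.+1 -> R^o := fun u => dotv u m.
  have l_linear : linear l by move=> a u v; rewrite /l dotvDl dotvZl.
  pose L : {linear 'rV[R]_n.+1 -> R^o} :=
    HB.pack l (GRing.isLinear.Build _ _ _ _ _ l_linear).
  by exists L, (- dotv (U i theta) m) => u; rewrite /phi dotvBl.
set G := Gset strict g
  in G_convex G_interior nrm_normal G_tangent delta_inward *.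
have [bG hyper _] := G_boundary.
have S_boundary i : Si strict g i `<=` boundary G by move=> u [].
have S_U i theta : Theta i theta -> Si strict g i (U i theta).
  by have [_ _ ->] := S_param i => Tt; exists theta.
have U_S i u : Si strict g i u -> exists2 theta, Theta i theta & U i theta = u.
  by have [_ _ ->] := S_param i.
have phi_int i theta u : Theta i theta -> interior G u ->
    0 < phi (U i) (delta i) u theta.
  move=> Tt Gu; have [f eqf] := hyper _ _ (S_U _ _ Tt).
  have [a a0 fE] :=
    grad_tangent_cross (S_param i) Tt (cross_neq0 _ _ Tt) eqf.
  have [_ inw] := delta_inward _ _ Tt.
  apply: (inward_normal_supporting (c := delta i theta / a) G_convex
    (S_boundary i) eqf _ inw Gu).
  by rewrite fE scalerA divfK.
have phi_cl i theta u : Theta i theta -> closure G u ->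
    0 <= phi (U i) (delta i) u theta.
  move=> Tt; apply: closure_halfspace => // v; exact: phi_int.
apply/seteqP; split=> u Gu.
  move=> i theta Tt; rewrite /succ0 /Order.lteif.
  have phi_ge0 := phi_cl i theta u Tt (subset_closure Gu).
  case: (boolP (i \in strict)) => //= istrict.
  rewrite lt_neqAle phi_ge0 andbT; apply/negP => /eqP phi0.
  have Sp := S_U _ _ Tt.
  have [[_ [f [c [eqf nE]]]] _] := nrm_normal _ _ istrict Sp.
  have [a a0 fE] :=
    grad_tangent_cross (S_param i) Tt (cross_neq0 _ _ Tt) eqf.
  have [d0 _] := delta_inward _ _ Tt.
  (* u lies in G and in the tangent hyperplane of S_i at U i theta. *)
  have : (set0 : set 'rV[R]_n.+1) u.
    rewrite -(G_tangent i istrict); split=> //.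
    exists (U i theta) => //=; rewrite nE fE !dotvZr.
    move/esym/eqP: phi0; rewrite /phi dotvZr mulf_eq0 (negbTE d0) /= => /eqP ->.
    by rewrite !mulr0.
  by [].
have phi_ge0 i theta : Theta i theta -> 0 <= phi (U i) (delta i) u theta.
  move=> Tt; have := Gu i theta Tt; rewrite /succ0 /Order.lteif.
  by case: ifP => // _ /ltW.
have [clGu|nclGu] := pselect (closure G u).
  move=> i; apply: contrapT => nGi.
  have Giu : closure (Gi strict g i) u.
    by apply: closure_subset clGu => v; exact.
  case: (boolP (i \in strict)) => [istrict|nstrict]; last first.
    by apply: nGi; exact: (Gi_closed i nstrict).
  have Su : Si strict g i u.
    split; split=> //.
      by move=> /interior_subset /(_ i).
    by move=> /interior_subset.
  have [theta Tt Utheta] := U_S _ _ Su.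
  have := Gu i theta Tt; rewrite /succ0 istrict /= /phi Utheta subrr dotv0l.
  by rewrite ltxx.
have [u0 Gu0] := G_interior.
have [t /andP[t0 t1] bt] := boundary_crossing Gu0 nclGu.
move: (bt); rewrite bG => -[i _ /U_S[theta Tt Utheta]].
have := phi_ge0 i theta Tt; have := phi_int i theta u0 Tt Gu0.
rewrite /phi Utheta; set m := _ *: tangent_cross _ _.
rewrite !dotvBl !dotvDl !dotvZl dotvBl.
set a := dotv u0 m; set b := dotv u m.
rewrite opprD addNKr oppr_gt0 pmulr_rlt0 // => ba.
have -> : b + (- a - t * (b - a)) = (1 - t) * (b - a) by ring.
by rewrite pmulr_rge0 ?subr_gt0 // leNgt ba.
Qed.
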